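(* Let $\mathbb{F}_q$ be a finite field of odd characteristic, let $a\in\mathbb{F}_q^*$ be a square in $\mathbb{F}_q^*$, let $b\in\mathbb{F}_q$ satisfy $b^2=a$, and let $n$ be a positive integer such that $\operatorname{rad}(n+1)$ divides $q-1$. Assume that $q\equiv 1\pmod 4$ or $n$ is even. Then every irreducible factor of $E_n(x,a)$ in $\mathbb{F}_q[x]$ is of the form $$D_t(x,a)-b^t(\alpha+\alpha^{-1}),$$ where $\alpha\in\mathbb{F}_q^*$ and $t$ is a positive divisor of $\frac{2(n+1)}{\gcd(2(n+1),q-1)}$ satisfying the following conditions: (i) $\alpha^{2(n+1)/t}=1$; (ii) $\operatorname{rad}(t)$ divides $\operatorname{ord}_q(\alpha)$; (iii) $\gcd\left(t,\frac{q-1}{\operatorname{ord}_q(\alpha)}\right)=1$; (iv) $(\alpha,t)\notin\{(1,1),(-1,1)\}$.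
   Context: For $n\ge 1$ and $a\in\mathbb{F}_q$, the $n$-th Dickson polynomials of the first and second kind with parameter $a$ are $D_n(x,a)=\sum_{i=0}^{\lfloor n/2\rfloor}\frac{n}{n-i}\binom{n-i}{i}(-a)^i x^{n-2i}$ and $E_n(x,a)=\sum_{i=0}^{\lfloor n/2\rfloor}\binom{n-i}{i}(-a)^i x^{n-2i}$ in $\mathbb{F}_q[x]$ (the numbers $\frac{n}{n-i}\binom{n-i}{i}$ are integers, viewed in $\mathbb{F}_q$). $\operatorname{rad}(n)$ is the product of the distinct primes dividing $n$, with $\operatorname{rad}(1)=1$. $\operatorname{ord}_q(\alpha)$ is the multiplicative order of $\alpha$ in the cyclic group $\mathbb{F}_q^*$. Irreducible factors are normalized to be monic. *)

(* Defs.v *)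
From HB Require Import structures.
From mathcomp Require Import all_boot all_order all_algebra all_fingroup.
Set Implicit Arguments.
Unset Strict Implicit.
Unset Printing Implicit Defensive.
Import GRing.Theory.
Local Open Scope ring_scope.

Definition radn (n : nat) : nat := (\prod_(p <- primes n) p)%N.

Definition dickson1_coef (n i : nat) : nat :=
  ((n * 'C(n - i, i)) %/ (n - i))%N.

(* The truncating division in [dickson1_coef] is exact in the range where the
   coefficient is used. *)
Lemma dickson1_coefE (n i : nat) : (0 < n)%N -> (i <= n./2)%N ->
  (dickson1_coef n i * (n - i) = n * 'C(n - i, i))%N.
Proof.
move=> n_gt0 le_in; rewrite /dickson1_coef divnK //.
have le_i : (i <= n)%N by rewrite (leq_trans le_in) // leq_half_double -addnn (leq_trans (leqnSn n)) // ltnS leq_addr.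
case: i le_in le_i => [|i] le_in le_i; first by rewrite subn0 dvdn_mulr.
rewrite -{2}(subnK le_i) mulnDl; apply: dvdn_add; first exact: dvdn_mulr.
case: (n - i.+1)%N => [|m]; first by rewrite bin0n muln0.
by rewrite -mul_bin_diag dvdn_mulr.
Qed.

(* Dickson polynomials of the first and second kind with parameter [a]; the
   first kind is meant for [0 < n] only. *)
Definition dickson1 (R : comNzRingType) (n : nat) (a : R) : {poly R} :=
  \sum_(i < n./2.+1) ((dickson1_coef n i)%:R * (- a) ^+ i) *: 'X^(n - i.*2).

Definition dickson2 (R : comNzRingType) (n : nat) (a : R) : {poly R} :=
  \sum_(i < n./2.+1) ('C(n - i, i)%:R * (- a) ^+ i) *: 'X^(n - i.*2).

(* Main.v *)
(* Write a root of [f] as [x0 = b (z + 1/z)] in an algebraic closure.  Since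
   [E_n(u + v, u v)] is the sum of the [u^(n-i) v^i], [z] is a root of unity of
   some order [d] dividing [2(n+1)], and [z^2 <> 1] because [n+1] is invertible.
   Put [t = d / gcd(d, q-1)]; then [alpha = z^t] is fixed by the Frobenius map
   and [x0] is a root of [D_t(x,a) - b^t (alpha + 1/alpha)], so [f] divides this
   polynomial of degree [t].  Conversely the Frobenius orbit of [x0] has some
   period [s <= deg f], so [z^(q^s)] is [z] or [1/z].  The second case would make
   [d] divide [q^s + 1], which is impossible as [rad d] divides [q-1] and
   [4 | d] forces [4 | q-1].  In the first case [d] divides
   [q^s - 1], and lifting the exponent gives [d | (q-1) s], i.e. [t | s]; hence [t <= deg f]. *)
Require Import Defs.
From HB Require Import structures.
From mathcomp Require Import all_boot all_order all_algebra all_fingroup.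
From mathcomp Require Import all_solvable all_field zify ring.
Set Implicit Arguments.
Unset Strict Implicit.
Unset Printing Implicit Defensive.
Import GRing.Theory.

(** * Radicals and lifting the exponent *)

Section Arithmetic.
Local Open Scope nat_scope.

Lemma dvdn_radn l n : prime l -> 0 < n -> l %| n -> l %| radn n.
Proof.
move=> pl n0 ln; rewrite /radn (big_rem l) ?dvdn_mulr //=.
by rewrite mem_primes pl n0.
Qed.

Lemma radn_dvdn t m : (forall l, prime l -> l %| t -> l %| m) -> radn t %| m.
Proof.
move=> H; rewrite /radn.
have {H} : {in primes t, forall l, prime l /\ l %| m}.
  by move=> l; rewrite mem_primes => /and3P[lp _ /H-> //].
elim: (primes t) (primes_uniq t) => [|l s IH] /=; first by rewrite big_nil dvd1n.
move=> /andP[ls us] H; rewrite big_cons.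
have [lp lm] := H l (mem_head _ _).
have Hs : {in s, forall k, prime k /\ k %| m}.
  by move=> k ks; apply: H; rewrite inE ks orbT.
rewrite Gauss_dvd ?lm ?IH // big_seq.
apply: (big_ind (coprime l)); first exact: coprimen1.
  by move=> x y; rewrite coprimeMr => -> ->.
move=> k ks; have [kp _] := Hs k ks; rewrite prime_coprime // dvdn_prime2 //.
by apply: contraNneq ls => ->.
Qed.

Lemma sum_expn_mod l q m : l %| q.-1 -> 0 < q ->
  \sum_(i < m) q ^ i = m %[mod l].
Proof.
move=> lq q0.
have q1 : q = 1 %[mod l] by apply/eqP; rewrite eqn_mod_dvd // subn1.
rewrite -[in RHS](muln1 m) -[in RHS](card_ord m) -sum_nat_const.
apply/eqP; elim: m => [|m /eqP IH]; first by rewrite !big_ord0.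
by rewrite !big_ord_recr /= -modnDm IH -(modnXm _ _ q) q1 modnXm exp1n modnDm.
Qed.

(** So (q^l - 1)/(q - 1) contains exactly one factor l. Expanding q^i = 1 + (q - 1)(1 + ... +
    q^(i-1)) leaves a double sum congruent to l(l - 1)/2, which is 0 mod l for odd l; for l = 2, q +
    1 is 2 mod 4. *)
Lemma sum_expn_prime l q : prime l -> 0 < q -> l %| q.-1 ->
  (odd l) || (4 %| q.-1) ->
  exists2 r, \sum_(i < l) q ^ i = l * r & coprime l r.
Proof.
move=> pl q0 lq Hl.
have [u qE] := dvdnP lq.
have l0 := prime_gt0 pl.
have l1 := prime_gt1 pl.
have [ol|/negbTE el] := boolP (odd l); last first.
  have -> : l = 2 by case: (even_prime pl) => // ol; rewrite ol in el.
  move: Hl; rewrite el /= => /dvdnP[w wE].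
  exists (1 + w * 2); last by rewrite coprime2n; lia.
  by rewrite big_ord_recr big_ord_recr big_ord0 /= expn1 expn0; lia.
have E : \sum_(i < l) q ^ i = l + (\sum_(i < l) \sum_(j < i) q ^ j) * (u * l).
  rewrite big_distrl /= -[X in X + _](card_ord l) -sum1_card -big_split /=.
  apply: eq_bigr => i _; rewrite mulnC -qE -predn_exp add1n prednK //.
  by rewrite expn_gt0 q0.
have S : l %| \sum_(i < l) \sum_(j < i) q ^ j.
  have Sk k : \sum_(i < k) \sum_(j < i) q ^ j = \sum_(i < k) i %[mod l].
    elim: k => [|k IH]; first by rewrite !big_ord0.
    by rewrite !big_ord_recr /= -modnDm IH (sum_expn_mod _ lq q0) modnDm.
  rewrite /dvdn Sk -(big_mkord xpredT id) bin2_sum bin2odd //.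
  by rewrite modnMr.
have [c cE] := dvdnP S.
exists (1 + (c * u) * l); last by rewrite addnC /coprime gcdnMDl gcdn1.
by rewrite E cE; lia.
Qed.

(* Lifting the exponent; [2] is exceptional, e.g. [8 %| 3 ^ 2 - 1]. *)
Lemma pfactor_dvdn_predexp l k q m : prime l -> 0 < q -> l %| q.-1 ->
  [|| odd l, 4 %| q.-1 | k <= 1] -> l ^ k %| (q ^ m).-1 -> l ^ k %| q.-1 * m.
Proof.
move=> pl q0 lq /or3P Hk.
have [k1|k1] := leqP k 1.
  by move=> _; apply: dvdn_mulr; apply: dvdn_trans lq; rewrite -{2}(expn1 l) dvdn_exp2l.
have {Hk} Hl : odd l || (4 %| q.-1).
  by case: Hk => [->|->|] //; rewrite ?orbT // leqNgt k1.
elim/ltn_ind: m k {k1} => m IH k.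
have [->|m0] := posnP m; first by rewrite muln0 dvdn0.
(* If l does not divide m, the cofactor of q - 1 in q^m - 1 is congruent to m mod l, so l^k already
   divides q - 1. *)
have [/dvdnP[m' mE]|lm] := boolP (l %| m); last first.
  rewrite predn_exp Gauss_dvdl; first by move=> ?; rewrite dvdn_mulr.
  rewrite coprimeXl // prime_coprime //.
  by rewrite /dvdn (sum_expn_mod _ lq q0).
case: k => [|k]; first by rewrite expn0 dvd1n.
have qm0 : 0 < q ^ m' by rewrite expn_gt0 q0.
have dv j : j %| q.-1 -> j %| (q ^ m').-1 by move=> ?; rewrite predn_exp dvdn_mulr.
(* Applied to q^m' with m = m' l, this cancels one l on each side and leaves the claim for m' <
   m. *)
have [|r rE rc] := sum_expn_prime pl qm0 (dv _ lq).
  by case/orP: Hl => [->|/dv ->]; rewrite ?orbT.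
rewrite mE expnM predn_exp rE mulnA Gauss_dvdl ?coprimeXl //.
rewrite expnSr dvdn_pmul2r ?prime_gt0 // mulnA dvdn_pmul2r ?prime_gt0 //.
apply: IH; rewrite mE -[X in X < _]muln1 ltn_pmul2l ?prime_gt1 //.
by move: m0; rewrite mE muln_gt0 => /andP[].
Qed.

Lemma dvdn_predexp d q m : 0 < q -> 0 < d ->
  (forall l, prime l -> l %| d -> l %| q.-1) -> (4 %| d -> 4 %| q.-1) ->
  d %| (q ^ m).-1 -> d %| q.-1 * m.
Proof.
move=> q0 d0 Hl H4 dq; apply/dvdn_partP => // l ld.
have [pl ldv] : prime l /\ l %| d by move: ld; rewrite mem_primes d0 => /andP[-> ].
rewrite p_part; apply: pfactor_dvdn_predexp => //; first exact: Hl.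
  (* For l = 2, either the exponent in d is at most 1 or 4 divides d. *)
  case: (even_prime pl) => [l2|->//]; case: ltnP => //; rewrite ?orbT //.
  rewrite l2 => k1; rewrite H4 ?orbT //.
  by rewrite -[4]/(2 ^ 2) pfactor_dvdn.
by apply: dvdn_trans dq; rewrite -p_part dvdn_part.
Qed.

Lemma dvdn_divgcd d m s : 0 < d -> d %| m * s -> d %/ gcdn d m %| s.
Proof.
move=> d0 dv; have g0 : 0 < gcdn d m by rewrite gcdn_gt0 d0.
rewrite -(@dvdn_pmul2r (gcdn d m)) // divnK ?dvdn_gcdl //.
by rewrite muln_gcdr dvdn_gcd dvdn_mull //= mulnC.
Qed.

End Arithmetic.

Local Open Scope ring_scope.

(** * Recurrences and evaluation of Dickson polynomials *)

Section Dickson.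
Variable R : comNzRingType.
Implicit Types (a u v : R) (n t : nat).

(** Past n/2 the binomials vanish, so the three sums of the recurrence can share one index range. *)
Lemma dickson2_widen n m a : (n./2 < m)%N ->
  dickson2 n a = \sum_(i < m) ('C(n - i, i)%:R * (- a) ^+ i) *: 'X^(n - i.*2).
Proof.
move=> nm; rewrite /dickson2.
rewrite (big_ord_widen m (fun i => ('C(n - i, i)%:R * (- a) ^+ i) *: 'X^(n - i.*2))) //.
rewrite big_mkcond; apply: eq_bigr => i _; case: ltnP => // ni.
by rewrite bin_small ?mul0r ?scale0r //; lia.
Qed.

Lemma dickson2_rec n a :
  dickson2 n.+2 a = 'X * dickson2 n.+1 a - a *: dickson2 n a.
Proof.
rewrite (@dickson2_widen n.+2 n.+2) ?(@dickson2_widen n.+1 n.+2);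
  rewrite ?(@dickson2_widen n n.+1); try lia.
rewrite big_ord_recl [in RHS]big_ord_recl /= mulrDr.
rewrite !expr0 !bin0 !mulr1 !scale1r !subn0 -exprS -addrA; congr (_ + _).
rewrite mulr_sumr scaler_sumr -sumrB; apply: eq_bigr => i _.
rewrite /bump /= add1n; have := ltn_ord i; move: (i : nat) => {}i i_n.
have -> : (n.+2 - i.+1 = (n - i).+1)%N by lia.
have -> : (n.+1 - i.+1 = n - i)%N by lia.
have -> : (n.+2 - i.+1.*2 = n - i.*2)%N by lia.
rewrite binS natrD mulrDl scalerDl; congr (_ + _); last first.
  by rewrite scalerA -scaleNr; congr (_ *: _); rewrite exprS; ring.
rewrite -scalerAr -exprS.
(* When n < 2i + 1, truncated subtraction makes the two exponents of X differ, but the coefficient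
   is 0. *)
have [ni|ni] := ltnP (n - i) i.+1; first by rewrite bin_small // !mul0r !scale0r.
by congr (_ *: 'X^_); lia.
Qed.

(** Both sides obey the recurrence with characteristic roots u and v. Stating (u^(n+1) - v^(n+1))/(u
    - v) as a sum also covers u = v. *)
Lemma horner_dickson2 n u v :
  (dickson2 n (u * v)).[u + v] = \sum_(i < n.+1) u ^+ (n - i) * v ^+ i.
Proof.
pose h k := \sum_(i < k) u ^+ (k.-1 - i) * v ^+ i.
rewrite -[RHS]/(h n.+1).
have hS k : h k.+1 = u * h k + v ^+ k.
  rewrite /h big_ord_recr /= subnn expr0 mul1r mulr_sumr; congr (_ + _).
  apply: eq_bigr => i _; rewrite mulrA -exprS.
  by congr (_ ^+ _ * _); have := ltn_ord i; lia.
have h1 : h 1%N = 1 by rewrite /h big_ord1 !expr0 mulr1.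
suff: (dickson2 n (u * v)).[u + v] = h n.+1 /\
      (dickson2 n.+1 (u * v)).[u + v] = h n.+2 by case.
elim: n => [|n [IH1 IH2]].
  split; first by rewrite /dickson2 big_ord1 h1 !hornerE.
  by rewrite hS h1 mulr1 /dickson2 big_ord1 !hornerE.
split=> //; rewrite dickson2_rec !hornerE IH1 IH2 (hS n.+2) (hS n.+1).
by rewrite !exprS; ring.
Qed.

(** With m = n + 2 this is m/(m - i) C(m - i, i) = C(m - i, i) + C(m - i - 1, i - 1), checked after
    multiplying by m - i. *)
Lemma dickson1_rec n a : dickson1 n.+2 a = dickson2 n.+2 a - a *: dickson2 n a.
Proof.
rewrite /dickson1 /dickson2 big_ord_recl [in RHS]big_ord_recl /= -addrA.
congr (_ + _); first by rewrite /dickson1_coef subn0 !bin0 muln1 divnn.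
rewrite scaler_sumr -sumrB; apply: eq_bigr => i _; rewrite /bump /= add1n.
have := ltn_ord i; move: (i : nat) => {}i i_n.
have -> : (n.+2 - i.+1.*2 = n - i.*2)%N by lia.
rewrite scalerA -scalerBl; congr (_ *: _).
have -> : dickson1_coef n.+2 i.+1 = ('C(n.+2 - i.+1, i.+1) + 'C(n - i, i))%N.
  apply/eqP; rewrite -(@eqn_pmul2r (n.+2 - i.+1)); last by lia.
  rewrite dickson1_coefE //.
  have -> : (n.+2 - i.+1 = (n - i).+1)%N by lia.
  have := mul_bin_diag (n - i).+1 i; rewrite /= mulnDl (mulnC 'C(n - i, i)) => ->.
  by rewrite (mulnC 'C(_, _)) -mulnDl; apply/eqP; congr (_ * _)%N; lia.
by rewrite natrD mulrDl exprS; ring.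
Qed.

Lemma horner_dickson1 t u v : (0 < t)%N ->
  (dickson1 t (u * v)).[u + v] = u ^+ t + v ^+ t.
Proof.
case: t => [//|[|n]] _; first by rewrite /dickson1 big_ord1 !hornerE.
rewrite dickson1_rec !hornerE !horner_dickson2.
(* The middle terms of the first sum cancel against u v times the second, leaving the two end
   terms. *)
rewrite big_ord_recl big_ord_recr /= /bump /= add1n subnn subn0 !expr0 mul1r mulr1.
rewrite -!addrA; congr (_ + _); rewrite addrC -addrA -[RHS]addr0; congr (_ + _).
apply/eqP; rewrite addrC subr_eq0 mulr_sumr; apply/eqP; apply: eq_bigr => i _.
rewrite mulrACA -!exprS; congr (_ ^+ _ * _); have := ltn_ord i; lia.
Qed.

Lemma size_dickson1_subXn t a : (0 < t)%N ->
  (size (dickson1 t a - 'X^t)%R <= t)%N.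
Proof.
move=> t0; rewrite /dickson1 big_ord_recl /= /dickson1_coef subn0 bin0 muln1.
rewrite divnn t0 expr0 mulr1 scale1r addrC addKr.
apply: (leq_trans (size_sum _ _ _)); apply/bigmax_leqP => i _.
by rewrite (leq_trans (size_scale_leq _ _)) // size_polyXn /bump /=; lia.
Qed.

End Dickson.

Section Map.
Variables (R S : comNzRingType) (h : {rmorphism R -> S}).

Lemma map_dickson1 n a : map_poly h (dickson1 n a) = dickson1 n (h a).
Proof.
rewrite /dickson1 rmorph_sum; apply: eq_bigr => i _.
by rewrite /= map_polyZ /= map_polyXn rmorphM rmorph_nat rmorphXn rmorphN.
Qed.

Lemma map_dickson2 n a : map_poly h (dickson2 n a) = dickson2 n (h a).
Proof.
rewrite /dickson2 rmorph_sum; apply: eq_bigr => i _.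
by rewrite /= map_polyZ /= map_polyXn rmorphM rmorph_nat rmorphXn rmorphN.
Qed.

End Map.

(** * Frobenius on an extension of a finite field *)

Section FiniteSubfield.
Variables (F : finFieldType) (K : fieldType) (iota : {rmorphism F -> K}).

Lemma pchar_nat_card : [pchar K].-nat #|F|.
Proof.
have [p _ chp] := finPcharP F.
have pF : p.-nat #|F|.
  by have := abelem_pgroup (fin_ring_pchar_abelem chp); rewrite /pgroup cardsT.
by rewrite (eq_pnat _ (pcharf_eq (rmorph_pchar iota chp))).
Qed.

Lemma pchar_nat_card_exp s : [pchar K].-nat (#|F| ^ s)%N.
Proof. by rewrite pnatX pchar_nat_card. Qed.

Lemma morph_expf_card_exp c s : iota c ^+ (#|F| ^ s) = iota c.
Proof.
by elim: s => [|s IH]; rewrite ?expr1 // expnSr exprM IH -rmorphXn /= expf_card.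
Qed.

Lemma expr_card_exp_inj s : injective (fun x : K => x ^+ (#|F| ^ s)).
Proof.
move=> x y /= xy; apply/eqP; rewrite -subr_eq0.
suff: (x - y) ^+ (#|F| ^ s) == 0 by rewrite expf_eq0 => /andP[].
by rewrite exprDn_pchar ?exprNn_pchar ?pchar_nat_card_exp // xy subrr.
Qed.

(** The q-th power map is additive and fixes the coefficients, so f(x^q) = f(x)^q. *)
Lemma root_map_expr_card f x :
  root (map_poly iota f) x -> root (map_poly iota f) (x ^+ #|F|).
Proof.
rewrite /root => /eqP fx0; have q0 : (0 < #|F|)%N by apply/card_gt0P; exists 0.
suff -> : (map_poly iota f).[x ^+ #|F|] = (map_poly iota f).[x] ^+ #|F|.
  by rewrite fx0 expr0n gtn_eqF.
rewrite !horner_coef (big_morph (fun y : K => y ^+ #|F|) (id1 := 0) (op1 := +%R)).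
- apply: eq_bigr => i _; rewrite coef_map exprMn exprAC.
  by have := morph_expf_card_exp f`_i 1; rewrite expn1 => ->.
- by move=> y z; rewrite exprDn_pchar ?pchar_nat_card.
- by rewrite expr0n gtn_eqF.
Qed.

(** Pigeonhole: x, x^q, x^(q^2), ... are all roots of f, so two of the first [size f] coincide;
    injectivity of Frobenius shifts the coincidence back to x. *)
Lemma root_map_frobenius_period f x : f != 0 -> root (map_poly iota f) x ->
  exists2 s, (0 < s < size f)%N & x ^+ (#|F| ^ s) = x.
Proof.
move=> f0 fx; pose r i := x ^+ (#|F| ^ i).
have rootr i : root (map_poly iota f) (r i).
  by elim: i => [|i IH]; rewrite /r ?expr1 // expnSr exprM root_map_expr_card.
have : ~~ uniq (mkseq r (size f)).
  apply/negP => Ur.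
  have := @max_poly_roots _ (map_poly iota f) (mkseq r (size f)).
  rewrite map_poly_eq0 size_map_poly size_mkseq ltnn => /(_ f0) H.
  suff: false by []; apply: H => //.
  by apply/allP => _ /mapP[i _ ->].
case/(uniqPn 0) => i [j [ij]]; rewrite size_mkseq => jm.
rewrite !nth_mkseq // ?(ltn_trans ij) // => rij.
exists (j - i)%N; first by lia.
have := ltnW ij => leij; apply: (@expr_card_exp_inj i) => /=.
by rewrite -exprM -expnD subnK.
Qed.

(** Evaluate at x the factorization of X^q - X into the X - c with c in F. *)
Lemma expr_card_fixed x : x ^+ #|F| = x -> exists c, iota c = x.
Proof.
move=> xq; have := congr1 (fun g => (map_poly iota g).[x]) (finField_genPoly F).
rewrite rmorphB /= map_polyXn map_polyX !hornerE xq subrr rmorph_prod.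
rewrite horner_prod => /esym/eqP /prodf_eq0[c _].
rewrite /= rmorphB /= map_polyX map_polyC !hornerE subr_eq0 => /eqP ->.
by exists c.
Qed.

End FiniteSubfield.

(** * The map sending z to z + 1/z *)

Lemma addf_inv_eq (K : fieldType) (y z : K) : y != 0 -> z != 0 ->
  y + y^-1 = z + z^-1 -> y = z \/ y = z^-1.
Proof.
move=> y0 z0 /eqP; rewrite -subr_eq0.
have -> : y + y^-1 - (z + z^-1) = (y - z) * (y - z^-1) / y by field; rewrite y0.
rewrite !mulf_eq0 invr_eq0 (negbTE y0) orbF !subr_eq0.
by case/orP => /eqP ->; [left | right].
Qed.

Lemma exists_add_inv (K : closedFieldType) (c : K) :
  exists2 z, z != 0 & c = z + z^-1.
Proof.
(* The equation solved is z^2 = c z - 1. *)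
have [z] := @solve_monicpoly K 2 (fun i => if i == 0%N then -1 else c) isT.
rewrite !big_ord_recl big_ord0 /= expr0 mulr1 addr0 expr1 => zE.
have z0 : z != 0.
  apply/eqP => z0; move: zE; rewrite z0 expr0n mulr0 addr0 => /eqP.
  by rewrite eq_sym oppr_eq0 oner_eq0.
exists z => //; apply: (mulIf z0); rewrite mulrDl mulVf // -expr2 zE.
by rewrite addrAC addNr add0r.
Qed.

(** * Irreducible factors of E_n *)

Theorem theorem4p2 (F : finFieldType) (p : nat) (charFp : p \in [pchar F])
    (odd_p : odd p) (a b : F) (a_neq0 : a != 0) (sqr_b : b ^+ 2 = a)
    (n : nat) (n_gt0 : (0 < n)%N) (rad_n : (radn n.+1 %| #|F|.-1)%N)
    (q1mod4_or_even : (#|F| = 1 %[mod 4])%N \/ ~~ odd n)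
    (f : {poly F}) (f_monic : f \is monic) (f_irr : irreducible_poly f)
    (f_dvd : f %| dickson2 n a) :
  exists (alpha : {unit F}) (t : nat),
    [/\ (0 < t)%N,
        (t %| (2 * n.+1) %/ gcdn (2 * n.+1) #|F|.-1)%N &
        f = dickson1 t a - (b ^+ t * (val alpha + (val alpha)^-1))%:P]
    /\
    [/\ val alpha ^+ ((2 * n.+1) %/ t)%N = 1,
        (radn t %| #[alpha]%g)%N,
        gcdn t (#|F|.-1 %/ #[alpha]%g) = 1%N &
        (val alpha, t) \notin [:: (1, 1%N); (-1, 1%N)]].
Proof.
set q := #|F| in rad_n q1mod4_or_even *; set N := (2 * n.+1)%N.
have q_gt1 : (1 < q)%N by exact: finNzRing_gt1.
have q_gt0 := ltnW q_gt1.
have p_pr := pcharf_prime charFp.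
have [k qE] : {k | q = p ^ k}%N.
  by apply: p_natP; rewrite -(eq_pnat _ (pcharf_eq charFp)) (pchar_nat_card idfun).
have p_q : (p %| q)%N.
  by move: q_gt1; rewrite qE; case: k {qE} => // k _; rewrite expnS dvdn_mulr.
have odd_q : odd q by rewrite qE oddX odd_p orbT.
have primeN l : prime l -> (l %| N)%N -> (l %| q.-1)%N.
  move=> l_pr; rewrite Euclid_dvdM // => /orP[|ln].
    rewrite dvdn_prime2 // => /eqP ->; rewrite dvdn2.
    by move: odd_q; rewrite -{1}(prednK q_gt0).
  exact: dvdn_trans (dvdn_radn _ _ ln) rad_n.
have n1_neq0 : n.+1%:R != 0 :> F.
  rewrite -(dvdn_pcharf charFp); apply/negP => pn.
  have : (p %| q.-1)%N by apply: primeN => //; rewrite dvdn_mull.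
  by move=> /(dvdn_sub p_q); rewrite -{1}(prednK q_gt0) subSnn dvdn1 gtn_eqF ?prime_gt1.
have four_q : (4 %| N)%N -> (4 %| q.-1)%N.
  case: q1mod4_or_even => [/eqP|n_even]; first by rewrite eqn_mod_dvd // subn1.
  by rewrite -[4%N]/(2 * 2)%N dvdn_pmul2l // dvdn2 /= n_even.
have [K [iota _]] := countable_algebraic_closure F.
have f_neq0 := monic_neq0 f_monic.
have [x0 fx0] : exists x, root (map_poly iota f) x.
  by apply/closed_rootP; rewrite size_map_poly; case: f_irr => /gtn_eqF->.
pose B := iota b.
have B_neq0 : B != 0.
  rewrite fmorph_eq0; apply: contraNneq a_neq0 => b0.
  by rewrite -sqr_b b0 expr0n.
have [z z_neq0 xz] := exists_add_inv (x0 / B).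
have x0E : x0 = B * z + B * z^-1 by rewrite -mulrDr -xz mulrC divfK.
have aE : iota a = B * z * (B * z^-1) by rewrite -sqr_b rmorphXn mulrACA divff // mulr1.
have Ex0 : \sum_(i < n.+1) (B * z) ^+ (n - i) * (B * z^-1) ^+ i = 0.
  rewrite -horner_dickson2 -aE -x0E -map_dickson2.
  have /dvdpP[g ->] := f_dvd.
  by rewrite rmorphM hornerM (eqP fx0) mulr0.
(* If z = 1/z, all summands of [Ex0] are equal and their sum (n + 1)(B z)^n is nonzero. *)
have z2_neq1 : z ^+ 2 != 1.
  apply/eqP => z2; have zV : z^-1 = z by apply: (mulfI z_neq0); rewrite divff // -expr2.
  move: Ex0; rewrite zV.
  under eq_bigr => i _ do rewrite -exprD subnK -1?ltnS //.
  rewrite sumr_const card_ord -mulr_natr => /eqP; rewrite mulf_eq0 expf_eq0 mulf_eq0.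
  rewrite (negbTE B_neq0) (negbTE z_neq0) andbF /= -(rmorph_nat iota) fmorph_eq0.
  exact/negP.
have zN : z ^+ N = 1.
  have : (B * z) ^+ n.+1 - (B * z^-1) ^+ n.+1 == 0 by rewrite subrXX Ex0 mulr0.
  rewrite !exprMn -mulrBr mulf_eq0 expf_eq0 (negbTE B_neq0) /= exprVn subr_eq0.
  by move=> /eqP zz; rewrite /N mulnC exprM expr2 {1}zz mulVf // expf_neq0.
have N_gt0 : (0 < N)%N by [].
have [d d_prim dN] := prim_order_exists N_gt0 zN.
have d_gt0 := prim_order_gt0 d_prim.
have d_prime l : prime l -> (l %| d)%N -> (l %| q.-1)%N.
  by move=> l_pr ld; apply: primeN => //; apply: dvdn_trans dN.
have d_4 : (4 %| d)%N -> (4 %| q.-1)%N by move=> d4; apply/four_q/(dvdn_trans d4).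
have d2 : ~~ (d %| 2)%N by rewrite (prim_order_dvd d_prim).
pose g := gcdn d q.-1; pose t := (d %/ g)%N.
have g_gt0 : (0 < g)%N by rewrite gcdn_gt0 d_gt0.
have dE : (t * g = d)%N by rewrite divnK ?dvdn_gcdl.
have t_gt0 : (0 < t)%N by rewrite divn_gt0 // dvdn_leq ?dvdn_gcdl.
have [c cE] : exists c, iota c = z ^+ t.
  apply: expr_card_fixed; rewrite -exprM -/q -(prednK q_gt0) mulnS exprD.
  suff /eqP -> : z ^+ (t * q.-1) == 1 by rewrite mulr1.
  by rewrite -(prim_order_dvd d_prim) -{1}dE dvdn_pmul2l // dvdn_gcdr.
have c_neq0 : c != 0 by rewrite -(fmorph_eq0 iota) cE expf_neq0.
have c_unit : c \is a GRing.unit by rewrite unitfE.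
pose alpha : {unit F} := FinRing.Unit c_unit.
have val_alpha : val alpha = c by [].
(* alpha^i = 1 iff d = t g divides t i, iff g divides i. *)
have o_alpha : #[alpha]%g = g.
  have alphaX i : (#[alpha]%g %| i)%N = (g %| i)%N.
    rewrite order_dvdn -val_eqE /= FinRing.val_unitX val_alpha.
    rewrite -(fmorph_eq1 iota) rmorphXn /= cE -exprM -(prim_order_dvd d_prim).
    by rewrite -{1}dE dvdn_pmul2l.
  by apply/eqP; rewrite eqn_dvd alphaX dvdnn -alphaX dvdnn.
pose G := dickson1 t a - (b ^+ t * (c + c^-1))%:P.
have [size_G G_monic] : size G = t.+1 /\ G \is monic.
  have szr : (size (G - 'X^t)%R <= t)%N.
    rewrite /G addrAC (leq_trans (size_polyD _ _)) // geq_max size_dickson1_subXn //.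
    by rewrite size_polyN (leq_trans (size_polyC_leq1 _)).
  have GE : G = 'X^t + (G - 'X^t) by rewrite addrC subrK.
  split; first by rewrite GE size_polyDl size_polyXn.
  by rewrite monicE GE lead_coefDl ?size_polyXn // lead_coefXn.
have Gx0 : root (map_poly iota G) x0.
  rewrite /root rmorphB /= map_dickson1 map_polyC /= aE x0E hornerD horner_dickson1 //.
  rewrite hornerN hornerC rmorphM rmorphD rmorphXn fmorphV /= cE -exprVn.
  by rewrite !exprMn -/B mulrDr subrr.
have f_G : f %| G.
  apply: contraT; rewrite -irreducible_poly_coprime // -(coprimep_map iota) => cop.
  by have := coprimep_root cop fx0; rewrite (eqP Gx0) eqxx.
have [s /andP[s_gt0 s_f] x0s] := root_map_frobenius_period f_neq0 fx0.
have Q_gt0 : (0 < q ^ s)%N by rewrite expn_gt0 q_gt0.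
(* Raising x0 = B z + B/z to the q^s fixes x0 and B, so z and z^(q^s) have the same sum with their
   inverses. *)
have zs : z ^+ (q ^ s) = z \/ z ^+ (q ^ s) = z^-1.
  apply: addf_inv_eq; rewrite ?expf_neq0 //; apply: (mulfI B_neq0).
  rewrite !mulrDr -x0E -[RHS]x0s x0E exprDn_pchar ?pchar_nat_card_exp //.
  by rewrite !exprMn exprVn /B morph_expf_card_exp.
have d_qs : (d %| (q ^ s).-1)%N.
  case: zs => zs.
    rewrite (prim_order_dvd d_prim); apply/eqP/(mulfI z_neq0).
    by rewrite -exprS prednK // zs mulr1.
  have dq : (d %| (q ^ s).+1)%N.
    by rewrite (prim_order_dvd d_prim) exprS zs divff.
  have qs1 l : (l %| q.-1)%N -> (l %| (q ^ s).-1)%N.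
    by move=> ?; rewrite predn_exp dvdn_mulr.
  (* Such an l divides both q^s + 1 and q^s - 1. *)
  have sub2 l : (l %| d)%N -> (l %| q.-1)%N -> (l %| 2)%N.
    move=> /dvdn_trans /(_ dq) h1 /qs1 h2.
    have <- : ((q ^ s).+1 - (q ^ s).-1 = 2)%N.
      by case: (q ^ s)%N Q_gt0 => // m _; rewrite -addn2 addKn.
    exact: dvdn_sub h1 h2.
  (* Every prime factor of [d] is now [2], and [4] does not divide [d]. *)
  case/negP: d2.
  have d4 : ~~ (4 %| d)%N by apply/negP => d4; have := sub2 _ d4 (d_4 d4).
  apply/dvdn_partP => // l; rewrite mem_primes => /and3P[l_pr _ ld].
  have := sub2 _ ld (d_prime _ l_pr ld); rewrite dvdn_prime2 // => /eqP l2.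
  move: d4; rewrite p_part l2 -[4%N]/(2 ^ 2)%N pfactor_dvdn // -ltnNge ltnS => d4.
  by rewrite -[X in (_ %| X)%N]/(2 ^ 1)%N dvdn_exp2l.
have t_s : (t %| s)%N by apply: dvdn_divgcd => //; apply: dvdn_predexp.
(* Both are monic, f divides G, and deg G = t <= s <= deg f. *)
have fG : f = G.
  apply/eqP; rewrite -eqp_monic // -dvdp_size_eqp // eqn_leq dvdp_leq ?monic_neq0 //=.
  by rewrite size_G (leq_ltn_trans _ s_f) // dvdn_leq.
exists alpha, t; rewrite o_alpha val_alpha; split; split=> //.
(* It suffices that d divides (q - 1) N / gcd(N, q - 1), a multiple of N. *)
- apply: dvdn_divgcd => //; rewrite mulnC.
  rewrite divn_mulAC ?dvdn_gcdl // -muln_divA ?dvdn_gcdr //.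
  by rewrite (dvdn_trans dN) // dvdn_mulr.
- apply: (fmorph_inj iota); rewrite rmorphXn rmorph1 /= cE -exprM mulnC divnK //.
  by rewrite (dvdn_trans _ dN) // -dE dvdn_mulr.
- apply: radn_dvdn => // l l_pr lt; have ld : (l %| d)%N by rewrite -dE dvdn_mulr.
  by rewrite dvdn_gcd ld d_prime.
(* Multiplied by g, condition (iii) becomes gcd(d, q - 1) = g. *)
- apply/eqP; rewrite -(eqn_pmul2r g_gt0) muln_gcdl dE mul1n divnK //.
  exact: dvdn_gcdr.
rewrite !inE !xpair_eqE negb_or !negb_and; apply/andP.
(* For t = 1, c is z itself, and z^2 is not 1. *)
suff H : t = 1%N -> c != 1 /\ c != -1.
  by have [t1|_] := eqVneq t 1%N; rewrite ?orbT //; have [-> ->] := H t1.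
move=> t1; move: z2_neq1; have -> : z = iota c by rewrite cE t1 expr1.
rewrite -rmorphXn fmorph_eq1 sqrf_eq1.
by rewrite negb_or => /andP[].
Qed.
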